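(* Let $(\hat{\mathcal M},\hat{\mathrm x})$ and $(\mathcal M,\mathrm x)$ be two minimal space-like surfaces of general type in $\mathbb R^4_1$, parameterized by canonical coordinates of the first type $t=u+\mathrm i v$ in one and the same domain $\mathcal D\subset\mathbb C$, and given by canonical Weierstrass representations with pairs of holomorphic functions $(\hat g_1,\hat g_2)$ and $(g_1,g_2)$ respectively. The following conditions are equivalent: (1) $(\hat{\mathcal M},\hat{\mathrm x})$ and $(\mathcal M,\mathrm x)$ are related by a transformation in $\mathbb R^4_1$ of the type $\hat{\mathrm x}(t)=A\,\mathrm x(t)+\mathrm b$, where $A\in\mathbf{SO}(3,1,\mathbb R)$ and $\mathrm b\in\mathbb R^4_1$. (2) The functions in the Weierstrass representations of $(\hat{\mathcal M},\hat{\mathrm x})$ and $(\mathcal M,\mathrm x)$ are related by $$\hat g_1=\frac{a g_1+b}{c g_1+d},\qquad \hat g_2=\frac{\bar d g_2-\bar c}{-\bar b g_2+\bar a},$$ for some $a,b,c,d\in\mathbb C$ with $ad-bc\neq0$.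
   Context: $\mathbb R^4_1$ is $\mathbb R^4$ with the indefinite product $a\cdot b=a_1b_1+a_2b_2+a_3b_3-a_4b_4$, extended bilinearly to $\mathbb C^4$; $a^2=a\cdot a$. $\mathbf{SO}(3,1,\mathbb R)$ is the group of real $4\times4$ matrices of determinant $1$ preserving this product. A surface $\mathcal M$ given by an immersion $\mathrm x$ is space-like if the induced metric on each tangent space $T_p(\mathcal M)$ is positive definite; $N_p(\mathcal M)$ is the normal space (signature $(1,1)$). The second fundamental form is $\sigma(X,Y)=(\nabla_XY)^\bot$, where $\nabla$ is the flat connection and $\bot$ is the projection to the normal space. The surface is minimal if $H=\frac12\operatorname{trace}\sigma=0$. It is of general type if it has no degenerate points, a point $p$ being degenerate if $\{\sigma(X,Y):X,Y\in T_p(\mathcal M)\}$ is contained in one of the two light-like one-dimensional subspaces of $N_p(\mathcal M)$. Coordinates $(u,v)$ are isothermal if $E=\mathrm x_u^2=\mathrm x_v^2$ and $\mathrm x_u\cdot\mathrm x_v=0$. Put $X_1=\mathrm x_u/\sqrt E$, $X_2=\mathrm x_v/\sqrt E$, $\Phi(t)=\mathrm x_u-\mathrm i\,\mathrm x_v$. Isothermal coordinates on a minimal space-like surface are canonical of the first type if $\sigma(X_1,X_1)\perp\sigma(X_1,X_2)$ and $E^2(\sigma(X_1,X_1)^2-\sigma(X_1,X_2)^2)=1$; equivalently $\Phi'^2=1$. A surface in canonical coordinates of the first type is given by the canonical Weierstrass representation with the pair $(g_1,g_2)$ of holomorphic functions if $g_1'g_2'\neq0$, $g_1\bar g_2\neq-1$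 everywhere and $\Phi=(\phi_1,\phi_2,\phi_3,\phi_4)$ with $$\phi_1=\frac{\mathrm i}{2}\,\frac{g_1g_2+1}{\sqrt{g_1'g_2'}},\quad \phi_2=\frac12\,\frac{g_1g_2-1}{\sqrt{g_1'g_2'}},\quad \phi_3=\frac12\,\frac{g_1+g_2}{\sqrt{g_1'g_2'}},\quad \phi_4=\frac12\,\frac{g_1-g_2}{\sqrt{g_1'g_2'}},$$ where $\sqrt{g_1'g_2'}$ is a holomorphic branch of the square root. A domain is a connected open set. *)

(* Defs.v *)
From HB Require Import structures.
From mathcomp Require Import all_boot all_order all_algebra.
From mathcomp Require Import all_classical all_reals all_analysis.
From mathcomp Require Import complex.

Set Implicit Arguments.
Unset Strict Implicit.
Unset Printing Implicit Defensive.

Import Order.TTheory GRing.Theory Num.Theory.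
Import numFieldNormedType.Exports.

Local Open Scope classical_set_scope.
Local Open Scope ring_scope.
Local Open Scope complex_scope.

Section Minkowski.
Variable R : realType.

Definition mdot (a b : 'cV[R]_4) : R :=
  a 0 0 * b 0 0 + a 1 0 * b 1 0 + a 2%:R 0 * b 2%:R 0 - a 3%:R 0 * b 3%:R 0.

Definition SO31 (A : 'M[R]_4) : Prop :=
  \det A = 1 /\ forall a b : 'cV[R]_4, mdot (A *m a) (A *m b) = mdot a b.

End Minkowski.

(* A parameterized surface is a map on R[i], of which only the values on the
   parameter domain matter; R[i] is identified with R^2 through t = u + i v. *)
Section Surfaces.
Variable R : realType.
Implicit Types (x : R[i] -> 'cV[R]_4) (D : set R[i]) (t a b : R[i]).

Definition on_plane x : R * R -> 'cV[R]_4 := fun p => x (p.1 +i* p.2).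

Definition plane_pt t : R * R := (complex.Re t, complex.Im t).

(* Real directional derivative along a: pd 1 x = x_u, pd 'i x = x_v, and
   pd a x t is the image of the direction a under the differential of x. *)
Definition pd a x : R[i] -> 'cV[R]_4 :=
  fun t => 'D_(plane_pt a) (on_plane x) (plane_pt t).

(* C^oo on the open set D: every iterated directional derivative is
   (Frechet) differentiable. *)
Definition smooth_on D x : Prop :=
  forall (s : seq R[i]) t, D t ->
    differentiable (on_plane (foldr pd x s)) (plane_pt t).

Definition immersion_on D x : Prop :=
  smooth_on D x /\ forall t a, D t -> pd a x t = 0 -> a = 0.

Definition tangent_space x t : set 'cV[R]_4 :=
  [set w | exists a, w = pd a x t].

Definition normal_space x t : set 'cV[R]_4 :=
  [set n | forall w, tangent_space x t w -> mdot n w = 0].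

Definition spacelike_on D x : Prop :=
  forall t w, D t -> tangent_space x t w -> w != 0 -> 0 < mdot w w.

(* The coordinate directions: basis_dir 0 is u, basis_dir 1 is v. *)
Definition basis_dir (i : 'I_2) : R[i] := if i == 0 then 1 else 'i%C.

Definition gram x t : 'M[R]_2 :=
  \matrix_(i, j) mdot (pd (basis_dir i) x t) (pd (basis_dir j) x t).

(* The orthogonal projection onto the normal space, w minus its tangential
   part, the latter written with the inverse g^{ij} of the metric. *)
Definition normal_part x t (w : 'cV[R]_4) : 'cV[R]_4 :=
  w - \sum_i \sum_j
        (invmx (gram x t) i j * mdot w (pd (basis_dir j) x t))
          *: pd (basis_dir i) x t.

(* sigma(X, Y) for X = dx_t(a) and Y = dx_t(b): Y is extended to the tangent
   field pd b x, so that nabla_X Y = pd a (pd b x) for the flat connection. *)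
Definition sigma x t a b : 'cV[R]_4 := normal_part x t (pd a (pd b x) t).

Definition mean_curvature x t : 'cV[R]_4 :=
  2^-1 *: \sum_i \sum_j
    invmx (gram x t) i j *: sigma x t (basis_dir i) (basis_dir j).

Definition minimal_on D x : Prop := forall t, D t -> mean_curvature x t = 0.

(* The light-like lines of the normal space are the lines spanned by its
   nonzero null vectors n. *)
Definition degenerate_point x t : Prop :=
  exists n : 'cV[R]_4,
    [/\ normal_space x t n, n != 0, mdot n n = 0 &
        forall a b, exists k : R, sigma x t a b = k *: n].

Definition general_type_on D x : Prop :=
  forall t, D t -> ~ degenerate_point x t.

Definition minimal_spacelike_general_type D x : Prop :=
  [/\ immersion_on D x, spacelike_on D x, minimal_on D x &
      general_type_on D x].

Definition metricE x t : R := mdot (pd 1 x t) (pd 1 x t).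

Definition isothermal_on D x : Prop :=
  forall t, D t ->
    mdot (pd 1 x t) (pd 1 x t) = mdot (pd 'i%C x t) (pd 'i%C x t) /\
    mdot (pd 1 x t) (pd 'i%C x t) = 0.

(* The directions of X_1 = x_u / sqrt E and X_2 = x_v / sqrt E. *)
Definition dir1 x t : R[i] := ((Num.sqrt (metricE x t))^-1)%:C.
Definition dir2 x t : R[i] := ((Num.sqrt (metricE x t))^-1)%:C * 'i%C.

Definition canonical_first_type_on D x : Prop :=
  isothermal_on D x /\
  forall t, D t ->
    let s11 := sigma x t (dir1 x t) (dir1 x t) in
    let s12 := sigma x t (dir1 x t) (dir2 x t) in
    mdot s11 s12 = 0 /\
    metricE x t ^+ 2 * (mdot s11 s11 - mdot s12 s12) = 1.

Definition Phi x t : 'cV[R[i]]_4 :=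
  \col_k ((pd 1 x t k 0)%:C - 'i%C * (pd 'i%C x t k 0)%:C).

(* The topology and normed structure of R[i] are those of R[i]^o; f is
   complex differentiable at every point of the open set D. *)
Definition holomorphic_on D (f : R[i] -> R[i]) : Prop :=
  forall t, D t -> derivable (f : R[i]^o -> R[i]^o) t 1.

Definition cderiv (f : R[i] -> R[i]) : R[i] -> R[i] := @derive1 R[i] R[i]^o f.

Definition domain D : Prop := open (D : set R[i]^o) /\ connected (D : set R[i]^o).

(* The function r below is the holomorphic branch of sqrt(g1' g2'). *)
Definition canonical_weierstrass D x (g1 g2 : R[i] -> R[i]) : Prop :=
  [/\ holomorphic_on D g1, holomorphic_on D g2,
      forall t, D t -> cderiv g1 t * cderiv g2 t != 0,
      forall t, D t -> g1 t * (g2 t)^* != -1 &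
      exists r : R[i] -> R[i],
        [/\ holomorphic_on D r,
            forall t, D t -> r t ^+ 2 = cderiv g1 t * cderiv g2 t &
            forall t, D t ->
              [/\ Phi x t 0 0 = 'i%C / 2 * ((g1 t * g2 t + 1) / r t),
                  Phi x t 1 0 = 1 / 2 * ((g1 t * g2 t - 1) / r t),
                  Phi x t 2%:R 0 = 1 / 2 * ((g1 t + g2 t) / r t) &
                  Phi x t 3%:R 0 = 1 / 2 * ((g1 t - g2 t) / r t)]]].

End Surfaces.

(* Main.v *)
Require Import Defs.
From mathcomp Require Import all_boot all_order all_algebra.
From mathcomp Require Import all_classical all_reals all_analysis.
From mathcomp Require Import complex.
From mathcomp Require Import ring lra.

(** The theorem is the isomorphism of PSL(2, C) with the identity component of
SO(3, 1), read off on Weierstrass data; the other component, obtained by the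
sign -1, exchanges the two branches of the square root of g_1' g_2'.

Replace the coordinates z_0, .., z_3 of a complex vector by its spinor
coordinates
  p = z_1 - i z_0,  q = z_2 + z_3,  s = z_2 - z_3,  t = - z_1 - i z_0,
regarded as the 2 x 2 matrix with rows (p, q) and (s, t).  The Minkowski
square becomes q s - p t, minus the determinant, and the vector Phi of a
Weierstrass representation becomes the rank one matrix
  (1 / r) (g_1, 1) (x) (g_2, 1),   r ^ 2 = g_1' g_2'
(spinor_coord_weierstrass).  A matrix B with rows (a, b) and (c, d) acts on
spinor coordinates through B (x) C, where C has rows
(a', b') = (conj d, - conj c) and (c', d') = (- conj b, conj a).  This action
multiplies the form by |det B| ^ 2 and commutes with the complex conjugation
of C^4, so that its rescaling by 1 / |det B| is the complexification of an
element of SO(3, 1) (spin_SO31); on rank one matrices it acts on g_1 and g_2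
exactly by the two Moebius transformations of the theorem (spin_mx_tensor).
Conversely every element of SO(3, 1) is, up to a sign, such an action
(SO31_spin): the images of the null vectors e_3 + e_2 and e_3 - e_2 are, up to
positive factors and a common sign, the squares of two spinors, and these
spinors are the columns of B; what is left is a rotation of a space-like plane,
that is a phase.

If xh = A x + b, then differentiation gives Phi(xh) = A Phi(x), and comparing
the two rank one matrices gives the Moebius relations, the denominators
being nonzero because the last coordinate 1 / rh of the left-hand side is.

If the Moebius relations hold, then rh ^ 2 = gh_1' gh_2' and the derivatives of
the gh_i give
  (rh (c g_1 + d) (c' g_2 + d')) ^ 2 = (|det B| r) ^ 2,
so that the two sides without the squares agree up to a sign, which is constant
since D is connected (equal_squares_sign).  Choosing A with this sign,
Phi(xh) = A Phi(x), so xh - A x has zero differential and is constant, again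
because D is connected (affine_of_pd). *)

Set Implicit Arguments.
Unset Strict Implicit.
Unset Printing Implicit Defensive.

Import Order.TTheory GRing.Theory Num.Theory.
Import numFieldNormedType.Exports.

Local Open Scope classical_set_scope.
Local Open Scope ring_scope.

(** * Matrices of size four given by their entries *)

(** The numerals of 'I_4 pass through its ring structure, whereas nth reduces on
these ordinals. *)
Definition o0 : 'I_4 := @Ordinal 4 0 isT.
Definition o1 : 'I_4 := @Ordinal 4 1 isT.
Definition o2 : 'I_4 := @Ordinal 4 2 isT.
Definition o3 : 'I_4 := @Ordinal 4 3 isT.

Lemma sum4 (V : nmodType) (F : 'I_4 -> V) :
  \sum_i F i = F o0 + F o1 + F o2 + F o3.
Proof.
rewrite !big_ord_recr big_ord0 /= add0r.
by do 3 (congr (_ + _); last by congr F; apply: val_inj); congr F; apply: val_inj.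
Qed.

Lemma ord4_ind (P : 'I_4 -> Prop) : P o0 -> P o1 -> P o2 -> P o3 -> forall i, P i.
Proof.
move=> p0 p1 p2 p3 [[|[|[|[|//]]]] h].
- by rewrite (_ : Ordinal h = o0)//; apply: val_inj.
- by rewrite (_ : Ordinal h = o1)//; apply: val_inj.
- by rewrite (_ : Ordinal h = o2)//; apply: val_inj.
- by rewrite (_ : Ordinal h = o3)//; apply: val_inj.
Qed.

Definition mx4 (T : nzRingType) (s : seq (seq T)) : 'M[T]_4 :=
  \matrix_(i, j) nth 0 (nth [::] s i) j.

Definition col4 (T : nzRingType) (s : seq T) : 'cV[T]_4 := \col_i nth 0 s i.

Ltac mx4_entries :=
  apply/matrixP; elim/ord4_ind; elim/ord4_ind; rewrite !(mxE, sum4) /=.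

Ltac col4_entries :=
  let i := fresh in let j := fresh in
  apply/matrixP => i j; rewrite (ord1 j); elim/ord4_ind: i;
  rewrite !(mxE, sum4) /=.

(** * Tensor products of matrices of size two *)

Section Kron.
Variable T : comNzRingType.
Implicit Types a b c d : T.

(** B (x) 1 on the coordinates (v1 w1, v1 w2, v2 w1, v2 w2) of v (x) w. *)
Definition lfactor a b c d : 'M[T]_4 := mx4
  [:: [:: a; 0; b; 0]; [:: 0; a; 0; b]; [:: c; 0; d; 0]; [:: 0; c; 0; d]].

(** 1 (x) B on the same coordinates. *)
Definition rfactor a b c d : 'M[T]_4 := mx4
  [:: [:: a; b; 0; 0]; [:: c; d; 0; 0]; [:: 0; 0; a; b]; [:: 0; 0; c; d]].

Definition swap_mx : 'M[T]_4 := mx4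
  [:: [:: 1; 0; 0; 0]; [:: 0; 0; 1; 0]; [:: 0; 1; 0; 0]; [:: 0; 0; 0; 1]].

(** The Gram matrix of the quadratic form 2 (q s - p t), which is -2 times the
determinant of the matrix with rows (p, q) and (s, t). *)
Definition spinor_form : 'M[T]_4 := mx4
  [:: [:: 0; 0; 0; -1]; [:: 0; 0; 1; 0]; [:: 0; 1; 0; 0]; [:: -1; 0; 0; 0]].

Lemma form_entry (M : 'M[T]_4) i j :
  (M^T *m spinor_form *m M) i j =
  M o1 i * M o2 j + M o2 i * M o1 j - M o0 i * M o3 j - M o3 i * M o0 j.
Proof. by rewrite !(mxE, sum4) /=; ring. Qed.

Lemma lfactorM a b c d a' b' c' d' :
  lfactor a b c d *m lfactor a' b' c' d' =
  lfactor (a * a' + b * c') (a * b' + b * d')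
          (c * a' + d * c') (c * b' + d * d').
Proof. by mx4_entries; ring. Qed.

Lemma rfactorM a b c d a' b' c' d' :
  rfactor a b c d *m rfactor a' b' c' d' =
  rfactor (a * a' + b * c') (a * b' + b * d')
          (c * a' + d * c') (c * b' + d * d').
Proof. by mx4_entries; ring. Qed.

Lemma lrfactorC a b c d a' b' c' d' :
  lfactor a b c d *m rfactor a' b' c' d' =
  rfactor a' b' c' d' *m lfactor a b c d.
Proof. by mx4_entries; ring. Qed.

Lemma lfactor_form a b c d :
  (lfactor a b c d)^T *m spinor_form *m lfactor a b c d =
  (a * d - b * c) *: spinor_form.
Proof.
rewrite -mulmxA.
have -> : spinor_form *m lfactor a b c d = mx4
    [:: [:: 0; -c; 0; -d];
        [:: c; 0; d; 0];
        [:: 0; a; 0; b]; [:: -a; 0; -b; 0]].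
  by mx4_entries; ring.
by mx4_entries; ring.
Qed.

Lemma rfactor_form a b c d :
  (rfactor a b c d)^T *m spinor_form *m rfactor a b c d =
  (a * d - b * c) *: spinor_form.
Proof.
rewrite -mulmxA.
have -> : spinor_form *m rfactor a b c d = mx4
    [:: [:: 0; 0; -c; -d];
        [:: 0; 0; a; b];
        [:: c; d; 0; 0]; [:: -a; -b; 0; 0]].
  by mx4_entries; ring.
by mx4_entries; ring.
Qed.

Lemma det2 a b c d :
  \det (\matrix_(i < 2, j < 2)
    nth 0 (nth [::] [:: [:: a; b]; [:: c; d]] i) j) = a * d - b * c.
Proof.
rewrite !(expand_det_row _ ord0) !big_ord_recr !big_ord0 /= /cofactor.
by rewrite !det_mx11 !mxE /=; ring.
Qed.

Lemma det_rfactor a b c d : \det (rfactor a b c d) = (a * d - b * c) ^+ 2.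
Proof.
rewrite -det2; set B := \matrix_(i, j) _.
have -> : rfactor a b c d = block_mx B 0 0 B :> 'M[T]_(2 + 2).
  apply/matrixP => i j.
  rewrite mxE [RHS]mxE; case: (splitP i) => k ki; rewrite mxE.
    by case: (splitP j) => l lj; rewrite !mxE ?ki ?lj; move: k l {ki lj};
      do 2 case=> [[|[|//]] ?].
  by case: (splitP j) => l lj; rewrite !mxE ?ki ?lj; move: k l {ki lj};
    do 2 case=> [[|[|//]] ?].
by rewrite (@det_ublock _ 2 2) expr2.
Qed.

(** B (x) 1 is conjugate to 1 (x) B under the exchange of the factors. *)
Lemma det_lfactor a b c d : \det (lfactor a b c d) = (a * d - b * c) ^+ 2.
Proof.
have swapK : swap_mx *m swap_mx = 1%:M by mx4_entries; ring.
have -> : lfactor a b c d = swap_mx *m rfactor a b c d *m swap_mx.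
  have -> : swap_mx *m rfactor a b c d = mx4 [:: [:: a; b; 0; 0];
      [:: 0; 0; a; b]; [:: c; d; 0; 0]; [:: 0; 0; c; d]] by mx4_entries; ring.
  by mx4_entries; ring.
by rewrite !det_mulmx mulrC mulrA -det_mulmx swapK det1 mul1r det_rfactor.
Qed.

Lemma det_cross a b c d : \det (mx4
  [:: [:: a; 0; 0; b]; [:: 0; 1; 0; 0]; [:: 0; 0; 1; 0]; [:: c; 0; 0; d]])
  = a * d - b * c.
Proof.
rewrite (expand_det_row _ (Ordinal (isT : 1 < 4)%N)).
rewrite (bigD1 (Ordinal (isT : 1 < 4)%N)) //= big1 => [|j]; last first.
  by rewrite mxE /=; case: j => [[|[|[|[|//]]]] ?] //=; rewrite mul0r.
rewrite mxE /= mul1r addr0 /cofactor /= expr2 mulrNN mul1r mul1r.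
rewrite (expand_det_row _ (Ordinal (isT : 1 < 3)%N)).
rewrite (bigD1 (Ordinal (isT : 1 < 3)%N)) //= big1 => [|j]; last first.
  by rewrite !mxE /=; case: j => [[|[|[|//]]] ?] //=; rewrite mul0r.
rewrite !mxE /= mul1r addr0 /cofactor /= expr2 mulrNN mul1r mul1r -det2.
by congr (\det _); apply/matrixP; do 2 (case=> [[|[|//]] ?]); rewrite !mxE.
Qed.

End Kron.

(** * The spin action of GL(2, C) *)

Section Spin.
Variable C : numClosedFieldType.
Implicit Types a b c d : C.

(** B (x) C, where C is the conjugate transpose of the adjugate of B; this choice
of C makes the action preserve the real vectors. *)
Definition spin_mx a b c d : 'M[C]_4 :=
  lfactor a b c d *m rfactor d^* (- c^*) (- b^*) a^*.

(** In spinor coordinates, the conjugation of C^4 fixing R^4 is the entrywise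
conjugation followed by (p, q, s, t) |-> (- t, q, s, - p). *)
Definition conj_sym : 'M[C]_4 := mx4
  [:: [:: 0; 0; 0; -1]; [:: 0; 1; 0; 0]; [:: 0; 0; 1; 0]; [:: -1; 0; 0; 0]].

Definition tensor (v1 v2 w1 w2 : C) : 'cV[C]_4 :=
  col4 [:: v1 * w1; v1 * w2; v2 * w1; v2 * w2].

Lemma spin_mxE a b c d : spin_mx a b c d = mx4
  [:: [:: a * d^*; - (a * c^*); b * d^*; - (b * c^*)];
      [:: - (a * b^*); a * a^*; - (b * b^*); b * a^*];
      [:: c * d^*; - (c * c^*); d * d^*; - (d * c^*)];
      [:: - (c * b^*); c * a^*; - (d * b^*); d * a^*]].
Proof. by rewrite /spin_mx; mx4_entries; ring. Qed.

Lemma spin_mxM a b c d a' b' c' d' :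
  spin_mx a b c d *m spin_mx a' b' c' d' =
  spin_mx (a * a' + b * c') (a * b' + b * d')
          (c * a' + d * c') (c * b' + d * d').
Proof.
rewrite /spin_mx mulmxA -[lfactor a b c d *m _ *m _]mulmxA -lrfactorC.
rewrite mulmxA lfactorM -mulmxA rfactorM; congr (_ *m rfactor _ _ _ _).
all: by rewrite !rmorphD !rmorphM /=; ring.
Qed.

Lemma spin_mx_tensor a b c d v1 v2 w1 w2 :
  spin_mx a b c d *m tensor v1 v2 w1 w2 =
  tensor (a * v1 + b * v2) (c * v1 + d * v2)
         (d^* * w1 - c^* * w2) (- b^* * w1 + a^* * w2).
Proof. by rewrite spin_mxE; col4_entries; ring. Qed.

(** The two factors multiply the form by det B and by the conjugate of det B. *)
Lemma spin_mx_form a b c d :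
  (spin_mx a b c d)^T *m spinor_form C *m spin_mx a b c d =
  ((a * d - b * c) * (a * d - b * c)^*) *: spinor_form C.
Proof.
rewrite /spin_mx trmx_mul -!mulmxA [_^T *m (spinor_form C *m _)]mulmxA.
rewrite (mulmxA (_^T *m _)) lfactor_form -scalemxAl -scalemxAr mulmxA.
rewrite rfactor_form scalerA; congr (_ * _ *: _).
by rewrite rmorphB !rmorphM /=; ring.
Qed.

Lemma det_spin_mx a b c d :
  \det (spin_mx a b c d) = ((a * d - b * c) * (a * d - b * c)^*) ^+ 2.
Proof.
rewrite det_mulmx det_lfactor det_rfactor -exprMn; congr (_ ^+ 2).
by rewrite rmorphB !rmorphM /=; ring.
Qed.

(** M is the complexification of a real operator in the coordinates z_0 .. z_3. *)
Definition conj_real (M : 'M[C]_4) :=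
  map_mx Num.conj M *m conj_sym = conj_sym *m M.

Lemma spin_mx_real a b c d : conj_real (spin_mx a b c d).
Proof.
rewrite /conj_real spin_mxE.
by mx4_entries; rewrite ?(rmorphN, rmorphM) /= ?conjCK; ring.
Qed.

Lemma null_spinor_pos (P Q S T : C) : 0 < Q -> T = - P^* -> P * T = Q * S ->
  exists v1 v2, [/\ P = - (v1 * v2^*), Q = v1 * v1^*, S = - (v2 * v2^*) &
                    T = v2 * v1^*].
Proof.
move=> Q0 TP PT.
have [r [r0 rr r2]] : exists r, [/\ r != 0, r^* = r & Q = r * r].
  exists (sqrtC Q); rewrite -expr2 sqrtCK sqrtC_eq0 gt_eqF//.
  by rewrite geC0_conj// sqrtC_ge0 ltW.
have Tc : T^* = - P by rewrite TP rmorphN /= conjCK.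
exists r, (T / r); rewrite rmorphM /= fmorphV /= rr Tc; split => //.
- by field.
- rewrite r2 in PT; apply: (mulfI (mulf_neq0 r0 r0)); rewrite -PT.
  by field.
- by field.
Qed.

(** A real null vector is, up to a sign, the square of a spinor (v1, v2): its
spinor matrix becomes Hermitian of determinant zero after its columns are
exchanged and one of them is negated, hence it is a multiple of v (conj v)^T by
a real number, whose absolute value v can absorb. *)
Lemma null_spinor (P Q S T : C) : Q \is Num.real -> S \is Num.real ->
  T = - P^* -> P * T = Q * S ->
  exists e v1 v2, (e = 1 \/ e = -1) /\
   [/\ P = e * - (v1 * v2^*), Q = e * (v1 * v1^*),
       S = e * - (v2 * v2^*) & T = e * (v2 * v1^*)].
Proof.
move=> Qr Sr TP PT.
case: (real_ltgt0P Qr) => [Q0|Q0|Q0].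
- have [v1 [v2 [h1 h2 h3 h4]]] := null_spinor_pos Q0 TP PT.
  by exists 1, v1, v2; rewrite !mul1r; split; [left|split].
- have [|||v1 [v2 [h1 h2 h3 h4]]] := @null_spinor_pos (- P) (- Q) (- S) (- T).
  + by rewrite oppr_gt0.
  + by rewrite TP rmorphN.
  + by rewrite !mulrNN.
  exists (-1), v1, v2; split; first by right.
  by split; apply: oppr_inj; rewrite ?h1 ?h2 ?h3 ?h4 ?mulN1r ?opprK.
have P0 : P = 0.
  by apply/eqP; rewrite -mul_conjC_eq0 -oppr_eq0 -mulrN -TP PT Q0 mul0r.
have T0 : T = 0 by rewrite TP P0 conjC0 oppr0.
have sq (x : C) : 0 <= x -> sqrtC x * (sqrtC x)^* = x.
  by move=> x0; rewrite geC0_conj ?sqrtC_ge0// -expr2 sqrtCK.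
rewrite P0 Q0 T0; case: (real_le0P Sr) => S0.
  exists 1, 0, (sqrtC (- S)); split; first by left.
  by rewrite sq ?oppr_ge0// conjC0 !mul0r !mulr0 !(oppr0, mul1r) ?opprK ?mulr0.
exists (-1), 0, (sqrtC S); split; first by right.
by rewrite sq ?ltW// conjC0 !mul0r !mulr0 !(oppr0, mulN1r) ?opprK ?mulr0 ?oppr0.
Qed.

Lemma conj_real_entries (M : 'M[C]_4) : conj_real M -> forall j,
  [/\ (M j o3)^* = - (conj_sym *m M) j o0, (M j o1)^* = (conj_sym *m M) j o1,
      (M j o2)^* = (conj_sym *m M) j o2 & (M j o0)^* = - (conj_sym *m M) j o3].
Proof.
move=> /matrixP HM j.
have H i : (M j o0)^* * conj_sym o0 i + (M j o1)^* * conj_sym o1 i +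
    (M j o2)^* * conj_sym o2 i + (M j o3)^* * conj_sym o3 i = (conj_sym *m M) j i.
  by rewrite -HM [in RHS]mxE sum4 !mxE.
by split; rewrite -H !mxE /=; ring.
Qed.

(** N preserves the plane of the coordinates p and t, where the form is - 2 p t;
its isometries there are diagonal or anti-diagonal, and the determinant excludes
the latter.  Reality makes the two diagonal entries conjugate, hence a phase and
its inverse: N is a rotation of a space-like plane. *)
Lemma spin_diag_form (N : 'M[C]_4) :
  N^T *m spinor_form C *m N = spinor_form C -> conj_real N -> \det N = 1 ->
  col o1 N = delta_mx o1 0 -> col o2 N = delta_mx o2 0 ->
  exists l, l * l^* = 1 /\ N = spin_mx l 0 0 1.
Proof.
move=> /matrixP HF HR HD /matrixP c1 /matrixP c2.
have E1 i : N i o1 = (i == o1)%:R by have := c1 i 0; rewrite !mxE andbT.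
have E2 i : N i o2 = (i == o2)%:R by have := c2 i 0; rewrite !mxE andbT.
have F i j := etrans (esym (form_entry N i j)) (HF i j).
have := F o0 o1; rewrite !(E1, E2, mxE) /= => N20.
have := F o0 o2; rewrite !(E1, E2, mxE) /= => N10.
have := F o3 o1; rewrite !(E1, E2, mxE) /= => N23.
have := F o3 o2; rewrite !(E1, E2, mxE) /= => N13.
have {}N20 : N o2 o0 = 0 by rewrite -N20; ring.
have {}N10 : N o1 o0 = 0 by rewrite -N10; ring.
have {}N23 : N o2 o3 = 0 by rewrite -N23; ring.
have {}N13 : N o1 o3 = 0 by rewrite -N13; ring.
have := F o0 o3.
rewrite !(E1, E2, mxE, N20, N10, N23, N13) /= => F03.
have [+ _ _ _] := conj_real_entries HR o0; rewrite mxE sum4 !mxE /= => R03.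
have [_ _ _ R00] := conj_real_entries HR o0; rewrite mxE sum4 !mxE /= in R00.
have NE : N = mx4 [:: [:: N o0 o0; 0; 0; N o0 o3]; [:: 0; 1; 0; 0];
                      [:: 0; 0; 1; 0]; [:: N o3 o0; 0; 0; N o3 o3]].
  by apply/matrixP; elim/ord4_ind; elim/ord4_ind;
    rewrite mxE ?E1 ?E2 ?N20 ?N10 ?N23 ?N13.
rewrite NE det_cross in HD.
have R33 : N o3 o3 = (N o0 o0)^* by rewrite R00; ring.
have R30 : N o3 o0 = (N o0 o3)^* by rewrite R03; ring.
have sys p q r s : p * s - q * r = 1 -> p * s + r * q = 1 ->
    p * s = 1 /\ q * r = 0 :> C.
  move=> h h'; have n2 : 2 != 0 :> C by rewrite pnatr_eq0.
  have ps : p * s = 1.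
    apply: (mulfI n2); transitivity ((p * s - q * r) + (p * s + r * q)).
      by ring.
    by rewrite h h'; ring.
  by split=> //; rewrite -(subrr 1) -[in X in _ - X]h ps; ring.
have [h1 h3] : N o0 o0 * N o3 o3 = 1 /\ N o0 o3 * N o3 o0 = 0.
  apply: sys => //; rewrite -[1]opprK -F03; ring.
rewrite R33 in h1.
have {}h3 : N o0 o3 = 0 by apply/eqP; rewrite -mul_conjC_eq0 -R30 h3.
exists (N o0 o0); split=> //.
rewrite spin_mxE {1}NE R30 R33 h3 !(conjC0, conjC1) h1.
by rewrite !(mulr0, mul0r, mulr1, mul1r, oppr0).
Qed.

(** The columns q and s of M are real null vectors, so null_spinor attaches to
them signs e, f and spinors v, w.  Their product 1 equals
- e f |det (v, w)| ^ 2, so e = - f and |det (v, w)| = 1.  The matrix with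
columns v and w thus produces an action with the same columns q and s as M up to
the sign e, and spin_diag_form applies to the quotient N. *)
Lemma spin_mx_onto (M : 'M[C]_4) :
  M^T *m spinor_form C *m M = spinor_form C -> conj_real M -> \det M = 1 ->
  exists e a b c d, [/\ e = 1 \/ e = -1,
    (a * d - b * c) * (a * d - b * c)^* = 1 & M = e *: spin_mx a b c d].
Proof.
move=> HF HR HD.
have F i j := etrans (esym (form_entry M i j))
  (congr1 (fun A : 'M[C]_4 => A i j) HF).
have Rq i : (M i o1)^* = (conj_sym *m M) i o1 by case: (conj_real_entries HR i).
have Rs i : (M i o2)^* = (conj_sym *m M) i o2 by case: (conj_real_entries HR i).
have [e [v1 [v2 [e1 [v0E v1E v2E v3E]]]]] : exists e v1 v2,
  (e = 1 \/ e = -1) /\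
  [/\ M o0 o1 = e * - (v1 * v2^*), M o1 o1 = e * (v1 * v1^*),
      M o2 o1 = e * - (v2 * v2^*) & M o3 o1 = e * (v2 * v1^*)].
  apply: null_spinor.
  - by apply/CrealP; rewrite Rq mxE sum4 !mxE /=; ring.
  - by apply/CrealP; rewrite Rq mxE sum4 !mxE /=; ring.
  - by rewrite Rq mxE sum4 !mxE /=; ring.
  - have := F o1 o1; rewrite mxE /= => E; apply: (mulfI (_ : 2 != 0 :> C)).
      by rewrite pnatr_eq0.
    apply/eqP; rewrite -subr_eq0; apply/eqP.
    by rewrite -[RHS]oppr0 -[in RHS]E; ring.
have [f [w1 [w2 [f1 [w0E w1E w2E w3E]]]]] : exists e v1 v2,
  (e = 1 \/ e = -1) /\
  [/\ M o0 o2 = e * - (v1 * v2^*), M o1 o2 = e * (v1 * v1^*),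
      M o2 o2 = e * - (v2 * v2^*) & M o3 o2 = e * (v2 * v1^*)].
  apply: null_spinor.
  - by apply/CrealP; rewrite Rs mxE sum4 !mxE /=; ring.
  - by apply/CrealP; rewrite Rs mxE sum4 !mxE /=; ring.
  - by rewrite Rs mxE sum4 !mxE /=; ring.
  - have := F o2 o2; rewrite mxE /= => E; apply: (mulfI (_ : 2 != 0 :> C)).
      by rewrite pnatr_eq0.
    apply/eqP; rewrite -subr_eq0; apply/eqP.
    by rewrite -[RHS]oppr0 -[in RHS]E; ring.
pose D := v1 * w2 - w1 * v2.
have DD : - (e * f) * (D * D^*) = 1.
  have := F o1 o2; rewrite mxE /= v0E v1E v2E v3E w0E w1E w2E w3E => <-.
  by rewrite /D rmorphB !rmorphM /=; ring.
have D0 : 0 <= D * D^* by exact: mul_conjC_ge0.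
have [fe DD1] : f = - e /\ D * D^* = 1.
  case: e1 f1 DD => -> [] -> //; rewrite !(mulNr, mulrN, mul1r, opprK) => H;
    split=> //;
    by move: D0; rewrite -oppr_le0 H ler10.
have ee : e * e = 1 by case: e1 => ->; rewrite ?mulrNN mulr1.
pose K := spin_mx v1 w1 v2 w2.
have Kdet : \det K = 1 by rewrite det_spin_mx -/D DD1 expr1n.
have KU : K \in unitmx by rewrite unitmxE Kdet unitr1.
have [N Ndef] : exists N, N = e *: (invmx K *m M) by eexists.
have MN : M = e *: (K *m N).
  by rewrite Ndef -scalemxAr mulKVmx// scalerA ee scale1r.
have KF : K^T *m spinor_form C *m K = spinor_form C.
  by rewrite spin_mx_form DD1 scale1r.
have ef : e * f = -1 by rewrite fe mulrN ee.
have ec : e^* = e by case: e1 => ->; rewrite ?rmorphN /= conjC1.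
have [|||||l [ll NE]] := @spin_diag_form N.
- transitivity (N^T *m (K^T *m spinor_form C *m K) *m N); first by rewrite KF.
  rewrite -[RHS]HF MN (_ : (e *: (K *m N))^T = e *: (K *m N)^T); last first.
    by rewrite linearZ.
  rewrite -scalemxAr -!scalemxAl scalerA ee.
  by rewrite scale1r (trmx_mul K N) -!mulmxA.
- have KR : conj_real K by exact: spin_mx_real.
  have : map_mx Num.conj K *m (map_mx Num.conj N *m conj_sym) =
      map_mx Num.conj K *m (conj_sym *m N).
    have KN : K *m N = e *: M by rewrite MN scalerA ee scale1r.
    rewrite [LHS]mulmxA -map_mxM KN map_mxZ /= ec -scalemxAl HR.
    by rewrite [RHS]mulmxA KR -[RHS]mulmxA KN -scalemxAr.
  by apply: (can_inj (mulKmx _)); rewrite unitmxE det_map_mx Kdet rmorph1 unitr1.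
- rewrite Ndef detZ det_mulmx det_inv Kdet HD invr1 !mulr1.
  by rewrite (exprM e 2 2) (expr2 e) ee expr1n.
- rewrite colE Ndef -scalemxAl -mulmxA -colE scalemxAr.
  apply: (canLR (mulKmx KU)); rewrite -colE /K spin_mxE.
  apply/matrixP => i j; elim/ord4_ind: i;
    by rewrite !mxE ?(v0E, v1E, v2E, v3E) mulrA ee /= mul1r; ring.
- rewrite colE Ndef -scalemxAl -mulmxA -colE scalemxAr.
  apply: (canLR (mulKmx KU)); rewrite -colE /K spin_mxE.
  apply/matrixP => i j; elim/ord4_ind: i;
    by rewrite !mxE ?(w0E, w1E, w2E, w3E) mulrA ef /= mulN1r; ring.
rewrite MN NE /K spin_mxM.
do 5 eexists; split; [exact: e1| |reflexivity].
rewrite !(mulr0, mulr1, addr0, add0r) -mulrA.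
by rewrite -[RHS]DD1 -[RHS]mul1r -ll /D !(rmorphB, rmorphM) /=; ring.
Qed.

End Spin.

(** * Spinor coordinates of Minkowski space *)

Definition mink_form (T : comNzRingType) : 'M[T]_4 := mx4
  [:: [:: 1; 0; 0; 0]; [:: 0; 1; 0; 0]; [:: 0; 0; 1; 0]; [:: 0; 0; 0; -1]].

Section Coord.
Variable C : numClosedFieldType.

(** Up to an exchange of columns and a sign, (p, q, s, t) are the entries of the
matrix with rows (z_3 + z_2, - z_1 + i z_0) and (- z_1 - i z_0, z_3 - z_2), the
Hermitian matrix usually attached to a vector of Minkowski space. *)
Definition spinor_coord : 'M[C]_4 := mx4
  [:: [:: - 'i; 1; 0; 0]; [:: 0; 0; 1; 1]; [:: 0; 0; 1; -1]; [:: - 'i; -1; 0; 0]].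

Lemma spinor_coord_form :
  spinor_coord^T *m spinor_form C *m spinor_coord = 2 *: mink_form C.
Proof.
have := sqrCi C; rewrite expr2 => ii; apply/matrixP => i j; rewrite form_entry.
elim/ord4_ind: i; elim/ord4_ind: j; by rewrite !mxE /=; ring: ii.
Qed.

Lemma spinor_coord_conj :
  map_mx Num.conj spinor_coord = conj_sym C *m spinor_coord.
Proof.
by mx4_entries; rewrite ?(rmorphN, rmorph0, rmorph1) /= ?conjCi; ring.
Qed.

Lemma spinor_coord_unit : spinor_coord \in unitmx.
Proof.
pose V : 'M[C]_4 := mx4 [:: [:: 'i; 0; 0; 'i]; [:: 1; 0; 0; -1];
                            [:: 0; 1; 1; 0]; [:: 0; 1; -1; 0]].
have := sqrCi C; rewrite expr2 => ii.
have E : V *m spinor_coord = 2 *: 1%:M.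
  by mx4_entries; ring: ii.
have : (2^-1 *: V) *m spinor_coord = 1%:M.
  by rewrite -scalemxAl E scalerA mulVf ?scale1r// pnatr_eq0.
by case/mulmx1_unit.
Qed.

Lemma lorentz_to_spinor (A M : 'M[C]_4) :
  spinor_coord *m A = M *m spinor_coord ->
  (A^T *m mink_form C *m A = mink_form C <->
   M^T *m spinor_form C *m M = spinor_form C) /\
  (map_mx Num.conj A = A <-> conj_real M) /\ \det M = \det A.
Proof.
have WU := spinor_coord_unit; set W := spinor_coord in WU *.
have WTU : W^T \in unitmx by rewrite unitmx_tr.
have n2 : 2 != 0 :> C by rewrite pnatr_eq0.
move=> WA.
have key : 2 *: (A^T *m mink_form C *m A) =
    W^T *m (M^T *m spinor_form C *m M) *m W.
  rewrite scalemxAl scalemxAr -spinor_coord_form -/W !mulmxA.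
  by rewrite -!trmx_mul -!mulmxA WA.
split; last split.
- split=> H.
    apply: (can_inj (mulKmx WTU)); apply: (can_inj (mulmxK WU)).
    by rewrite -key H -spinor_coord_form.
  by apply: (scalerI n2); rewrite key H -spinor_coord_form.
- have WcU : map_mx Num.conj W \in unitmx.
    by rewrite unitmxE det_map_mx rmorph_unit// -unitmxE.
  have cW := spinor_coord_conj; rewrite -/W in cW.
  have key2 : map_mx Num.conj W *m map_mx Num.conj A =
    map_mx Num.conj M *m conj_sym C *m W.
    by rewrite -map_mxM WA map_mxM cW mulmxA.
  have key3 : map_mx Num.conj W *m A = conj_sym C *m M *m W.
    by rewrite cW -!mulmxA WA.
  split=> [H|H].
    by apply: (can_inj (mulmxK WU)); rewrite -key2 H key3.
  by apply: (can_inj (mulKmx WcU)); rewrite key2 key3 H.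
- apply: (mulfI (_ : \det W != 0)); first by rewrite -unitfE -unitmxE.
  by rewrite mulrC -!det_mulmx WA.
Qed.

Lemma spinor_coord_weierstrass (f : 'cV[C]_4) (g1 g2 r : C) :
  f o0 0 = 'i / 2 * ((g1 * g2 + 1) / r) ->
  f o1 0 = 1 / 2 * ((g1 * g2 - 1) / r) ->
  f o2 0 = 1 / 2 * ((g1 + g2) / r) ->
  f o3 0 = 1 / 2 * ((g1 - g2) / r) ->
  spinor_coord *m f = r^-1 *: tensor g1 1 g2 1.
Proof.
move=> f0 f1 f2 f3; apply/matrixP => i j; rewrite ord1 {j}.
have := sqrCi C; rewrite expr2 => ii.
have n2 : 2 != 0 :> C by rewrite pnatr_eq0.
elim/ord4_ind: i; rewrite !(mxE, sum4) /= f0 f1 f2 f3; move: r^-1 => q.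
- transitivity ((- ('i * 'i) * (g1 * g2 + 1) + (g1 * g2 - 1)) / 2 * q).
    by ring.
  by rewrite ii; field.
- transitivity (((g1 + g2) + (g1 - g2)) / 2 * q); first by ring.
  by field.
- transitivity (((g1 + g2) - (g1 - g2)) / 2 * q); first by ring.
  by field.
- transitivity ((- ('i * 'i) * (g1 * g2 + 1) - (g1 * g2 - 1)) / 2 * q).
    by ring.
  by rewrite ii; field.
Qed.

(** The coordinate kh on the left is k v2 w2 on the right, so v2 and w2 are
nonzero. *)
Lemma tensor_ratio (k kh g1 g2 v1 v2 w1 w2 : C) : kh != 0 ->
  kh *: tensor g1 1 g2 1 = k *: tensor v1 v2 w1 w2 ->
  [/\ v2 != 0, g1 = v1 / v2, w2 != 0 & g2 = w1 / w2].
Proof.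
move=> kh0 /matrixP H.
have E1 := H o1 0; have E2 := H o2 0; have E3 := H o3 0.
rewrite !mxE /= !(mulr1, mul1r) in E1 E2 E3.
have /andP[k0 /andP[v0 w0]] : (k != 0) && ((v2 != 0) && (w2 != 0)).
  by move: kh0; rewrite E3 !mulf_eq0 !negb_or.
split=> //.
  by apply: (mulfI kh0); rewrite E1 E3; field.
by apply: (mulfI kh0); rewrite E2 E3; field.
Qed.

Lemma tensor_mobius (k r rh e n g1 g2 v1 v2 w1 w2 : C) : r != 0 -> n != 0 ->
  v2 != 0 -> w2 != 0 -> e = 1 \/ e = -1 ->
  rh * v2 * w2 = e * (n * r) ->
  rh^-1 *: tensor (v1 / v2) 1 (w1 / w2) 1 = (e / n) *: (r^-1 *: tensor v1 v2 w1 w2).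
Proof.
move=> r0 n0 v0 w0 e1 E.
have e0 : e != 0 by case: e1 => ->; rewrite ?oppr_eq0 oner_eq0.
have ee : e^-1 = e by case: e1 => ->; rewrite ?invrN invr1.
have -> : rh = e * (n * r) / (v2 * w2).
  by rewrite -E; field; rewrite v0 w0.
apply/matrixP => i j; rewrite ord1 {j} -{2}ee.
by elim/ord4_ind: i; rewrite !mxE /=; field; rewrite ?r0 ?n0 ?v0 ?w0 ?e0.
Qed.

End Coord.

(** * The spin action and SO(3, 1) *)

Section Real.
Variable R : realType.
Local Notation toC := (map_mx (real_complex R)).
Local Notation W := (spinor_coord R[i]).

Lemma mdotE (a b : 'cV[R]_4) : mdot a b = (a^T *m mink_form R *m b) 0 0.
Proof.
rewrite /mdot.
(* In decreasing order, because 2 and 3 are sums of ones in 'I_4. *)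
have -> : (3%:R : 'I_4) = o3 by exact: val_inj.
have -> : (2%:R : 'I_4) = o2 by exact: val_inj.
have -> : (1 : 'I_4) = o1 by exact: val_inj.
have -> : (0 : 'I_4) = o0 by exact: val_inj.
by rewrite !(mxE, sum4) /=; ring.
Qed.

Lemma SO31E (A : 'M[R]_4) :
  SO31 A <-> \det A = 1 /\ A^T *m mink_form R *m A = mink_form R.
Proof.
split=> -[dA H]; split=> //.
  have E (B : 'M[R]_4) i j :
      ((delta_mx i 0 : 'cV_4)^T *m B *m (delta_mx j 0 : 'cV_4)) 0 0 = B i j.
    by rewrite trmx_delta -rowE -colE !mxE.
  apply/matrixP => i j; rewrite -E -[RHS]E -mdotE -H mdotE.
  by rewrite trmx_mul !mulmxA.
move=> a b; rewrite !mdotE trmx_mul !mulmxA.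
by rewrite -(mulmxA _ _ A) -(mulmxA _ A^T) (mulmxA A^T) H.
Qed.

Lemma toC_mink : toC (mink_form R) = mink_form R[i].
Proof.
by mx4_entries; rewrite ?(rmorphN, rmorph0, rmorph1).
Qed.

Lemma toC_form (A : 'M[R]_4) : A^T *m mink_form R *m A = mink_form R <->
  (toC A)^T *m mink_form R[i] *m toC A = mink_form R[i].
Proof.
rewrite -toC_mink map_trmx -!map_mxM; split=> [->//|].
by move/map_mx_inj; exact.
Qed.

Lemma toC_real (A : 'M[R]_4) : map_mx Num.conj (toC A) = toC A.
Proof. by apply/matrixP => i j; rewrite !mxE; exact: conjc_real. Qed.

Lemma SO31_spin (A : 'M[R]_4) : SO31 A ->
  exists e a b c d, [/\ e = 1 \/ e = -1, a * d - b * c != 0 &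
    W *m toC A = e *: (spin_mx a b c d *m W)].
Proof.
move/SO31E => [dA HA].
have WU := spinor_coord_unit R[i].
pose M := W *m toC A *m invmx W.
have WA : W *m toC A = M *m W by rewrite mulmxKV.
have [h1 [h2 h3]] := lorentz_to_spinor WA.
have [] := @spin_mx_onto _ M.
- by apply/h1/toC_form.
- by apply/h2/toC_real.
- by rewrite h3 det_map_mx dA rmorph1.
move=> e [a [b [c [d [e1 D1 ME]]]]]; exists e, a, b, c, d; split=> //.
  by apply/eqP => D0; move: D1; rewrite D0 mul0r => /eqP; rewrite eq_sym oner_eq0.
by rewrite WA ME -scalemxAl.
Qed.

(** The factor 1 / |det B| makes the action isometric of determinant 1, and the sign
e changes neither, since the dimension is even. *)
Lemma spin_SO31 (e a b c d : R[i]) : e = 1 \/ e = -1 -> a * d - b * c != 0 ->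
  exists A : 'M[R]_4, SO31 A /\
    W *m toC A = (e / `|a * d - b * c|) *: (spin_mx a b c d *m W).
Proof.
set D := a * d - b * c => e1 D0.
have WU := spinor_coord_unit R[i].
have k0 : `|D| != 0 by rewrite normr_eq0.
pose k := e / `|D|; pose M := k *: spin_mx a b c d.
have kD : k * k * (D * D^*) = 1.
  rewrite -normCK /k; case: e1 => ->; field; exact: k0.
have kc : k^* = k.
  rewrite /k rmorphM /= fmorphV /= conj_normC; congr (_ / _).
  by case: e1 => ->; rewrite ?rmorphN /= conjC1.
pose B := invmx W *m M *m W.
have WB : W *m B = M *m W by rewrite /B !mulmxA mulmxV// mul1mx.
have [h1 [h2 h3]] := lorentz_to_spinor WB.
have Bform : B^T *m mink_form R[i] *m B = mink_form R[i].
  apply/h1; rewrite /M (_ : (k *: _)^T = k *: (spin_mx a b c d)^T);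
    last by rewrite linearZ.
  by rewrite -scalemxAr -!scalemxAl scalerA spin_mx_form scalerA kD scale1r.
have Breal : map_mx Num.conj B = B.
  apply/h2; rewrite /conj_real map_mxZ /= kc -scalemxAl -scalemxAr.
  by rewrite spin_mx_real.
have BE : toC (map_mx (@complex.Re R) B) = B.
  apply/matrixP => i j; rewrite 2!mxE; apply: RRe_real; apply/CrealP.
  by move/matrixP/(_ i j): Breal; rewrite mxE.
exists (map_mx (@complex.Re R) B).
rewrite BE; split; last by rewrite WB /M -scalemxAl.
apply/SO31E; split; last by apply/toC_form; rewrite BE.
apply: (@complexI R); rewrite -det_map_mx BE -h3 detZ det_spin_mx rmorph1 /=.
by rewrite -/D (exprM k 2 2) -exprMn (expr2 k) kD expr1n.
Qed.

End Real.

Local Open Scope complex_scope.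

(** * Constancy on connected domains of the plane *)

Section Plane.
Variable R : realType.

Lemma realC_norm (r : R) : `|r%:C| = `|r|%:C.
Proof. by rewrite normc_def /= expr0n addr0 sqrtr_sqr. Qed.

Lemma normci : `|'i%C : R[i]| = 1.
Proof. by rewrite normc_def /= expr0n expr1n add0r sqrtr1. Qed.

Lemma complex_norm_le (z : R[i]) :
  `|z| <= (`|complex.Re z| + `|complex.Im z|)%:C.
Proof.
rewrite {1}[z]complexE rmorphD /= -!realC_norm.
apply: (le_trans (ler_normD _ _)); rewrite lerD2l normrM.
by rewrite normci mul1r.
Qed.

Lemma pos_complexE (e : R[i]) : 0 < e -> exists2 r : R, 0 < r & e = r%:C.
Proof. by case: e => a b; rewrite ltcE /= => /andP[/eqP -> a0]; exists a. Qed.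

(** R[i] carries the topology of its complex absolute value, R * R that of the
maximum norm; this lemma and the next say that they agree. *)
Lemma near_plane (t : R[i]) (P : set R[i]) :
  (\forall s \near (t : R[i]^o), P s) ->
  \forall p \near plane_pt t, P (p.1 +i* p.2).
Proof.
move=> /nbhs_ballP[e /pos_complexE[r r0 ->] rP].
apply/nbhs_ballP; exists (r / 2); first by rewrite /= divr_gt0.
move=> [u v] [/= hu hv]; apply: rP.
rewrite -ball_normE /ball_ /=.
rewrite -ball_normE /ball_ /= in hu; rewrite -ball_normE /ball_ /= in hv.
apply: (le_lt_trans (complex_norm_le _)); rewrite ltcR.
case: t hu hv => a b /= hu hv; lra.
Qed.

Lemma plane_near (t : R[i]) (P : set (R * R)) :
  (\forall p \near plane_pt t, P p) ->
  \forall s \near (t : R[i]^o), P (plane_pt s).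
Proof.
move=> /nbhs_ballP[e e0 rP].
apply/nbhs_ballP; exists e%:C; first by rewrite /= ltcR.
move=> s; rewrite -ball_normE /ball_ /= => ts; apply: rP.
split; rewrite -ball_normE /ball_ /= -ltcR; apply: le_lt_trans ts.
  case: t s => a b [a' b']; exact: (normc_ge_Re ((a +i* b) - (a' +i* b'))).
have -> : `|t - s| = `|(t - s) * 'i%C|.
  by rewrite normrM normci mulr1.
rewrite -normrN; case: t s => a b [a' b'].
by have := normc_ge_Re (((a +i* b) - (a' +i* b')) * 'i%C); rewrite ReiNIm.
Qed.

Lemma locally_constant (T : Type) (D : set R[i]) (f : R[i] -> T) : domain D ->
  (forall t, D t -> \forall s \near (t : R[i]^o), f s = f t) ->
  forall s t, D s -> D t -> f s = f t.
Proof.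
move=> [Dop Dco] lc s t Ds Dt.
have op P : open [set z : R[i]^o | D z /\ P (f z)].
  rewrite openE => z [Dz Pz].
  apply: filterS2 (open_nbhs_nbhs (conj Dop Dz)) (lc z Dz).
  by move=> w Dw wz; split=> //; rewrite wz.
suff E : [set z : R[i]^o | D z /\ f z = f t] = D.
  by move: Ds; rewrite -{1}E => -[].
apply: Dco.
- by exists t.
- exists [set z : R[i]^o | D z /\ f z = f t]; first exact: (op [set w | w = f t]).
  by apply/seteqP; split=> z /= => [[Dz fz]|[_ []]].
- exists (~` [set z : R[i]^o | D z /\ f z <> f t]).
    by rewrite closedC; exact: (op [set w | w <> f t]).
  apply/seteqP; split=> z /= => [[Dz fz]|[Dz nz]]; split=> //.
    by move=> [].
  by apply: contrapT => fz; apply: nz.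
Qed.

(** The two partial derivatives determine the differential, and the mean value
theorem applies on the segment from p to q. *)
Lemma const_of_zero_differential (f : R * R -> R) (p : R * R) :
  (\forall q \near p, differentiable f q) ->
  (\forall q \near p, 'D_(1, 0) f q = 0 /\ 'D_(0, 1) f q = 0) ->
  \forall q \near p, f q = f p.
Proof.
move=> df Df.
have : \forall q \near p, differentiable f q /\ forall v, 'd f q v = 0.
  near=> q.
  have dfq : differentiable f q by near: q.
  split=> // v.
  have [D1 D2] : 'D_(1, 0) f q = 0 /\ 'D_(0, 1) f q = 0 by near: q.
  rewrite (_ : v = v.1 *: (1, 0) + v.2 *: (0, 1)); last first.
    by case: v => v1 v2; congr (_, _);
      rewrite /= ?scaler0 ?addr0 ?add0r /GRing.scale /= mulr1.
  by rewrite linearD !linearZ /= -!deriveE// D1 D2 !scaler0 addr0.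
move=> /nbhs_ballP[e e0 He]; apply/nbhs_ballP; exists e => // q pq.
pose g (s : R) := p + s *: (q - p).
have gball (s : R) : 0 <= s <= 1 -> ball p e (g s).
  move=> /andP[s0 s1]; move: pq; rewrite -!ball_normE /ball_ /=.
  rewrite -[in X in _ -> X]normrN opprB /g addrAC subrr add0r normrZ.
  rewrite (ger0_norm s0).
  rewrite -normrN opprB; apply: le_lt_trans.
  by rewrite ler_piMl.
have dg (s : R) : 0 <= s <= 1 -> is_derive s (1 : R) (f \o g) 0.
  move=> /gball/He[dfg dfg0].
  have dgs : differentiable g s.
    apply: differentiableD => //; exact: differentiableZl.
  have dc : differentiable (f \o g) s by exact: differentiable_comp.
  apply: DeriveDef; first exact/derivable1_diffP.
  by rewrite deriveE// diff_comp//= dfg0.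
have [|||c _] := @MVT_segment R (f \o g) (fun=> 0) 0 1.
- exact: ler01.
- by move=> s; rewrite in_itv /= => /andP[s0 s1]; apply: dg; rewrite !ltW.
- apply: derivable_within_continuous => s; rewrite in_itv /= => s01.
  by have [] := dg s s01.
rewrite mul0r /= /g scale1r scale0r addr0 addrCA subrr addr0 => /eqP.
by rewrite subr_eq0 => /eqP.
Unshelve. all: by end_near. Qed.

End Plane.

(** * Affine images of parameterized surfaces *)

Section Affine.
Variable R : realType.

Lemma is_derive_affine (V : normedModType R) m n (f : V -> 'cV[R]_n)
    (A : 'M[R]_(m, n)) (b : 'cV[R]_m) p v : derivable f p v ->
  is_derive p v (fun q => A *m f q + b) (A *m 'D_v f p).
Proof.
move=> df.
have dfi k j : is_derive p v (fun q => f q k j) ('D_v f p k j).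
  apply: DeriveDef; first exact: (derivable_mxP _ _ _).1.
  by rewrite derive_mx// mxE.
have dA i j : is_derive p v (fun q => (A *m f q + b) i j) ((A *m 'D_v f p) i j).
  rewrite [X in is_derive _ _ X _](_ : _ =
    (\sum_k (A i k \*: (fun q => f q k j)) + cst (b i j))); last first.
    apply/funext => q; rewrite !mxE fctE /=; congr (_ + _).
    by rewrite fct_sumE; apply: eq_bigr.
  rewrite [X in is_derive _ _ _ X](_ : _ =
    \sum_k (A i k *: 'D_v f p k j) + 0); last by rewrite addr0 mxE.
  exact: is_deriveD.
have dd : derivable (fun q => A *m f q + b) p v.
  by apply/derivable_mxP => i j; have [] := dA i j.
apply: DeriveDef => //; rewrite derive_mx//; apply/matrixP => i j.
by rewrite mxE; apply: derive_val.
Qed.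

Implicit Types (x : R[i] -> 'cV[R]_4) (D : set R[i]).

Lemma pd_affine D xh x A b : open (D : set R[i]^o) ->
  smooth_on D x -> (forall t, D t -> xh t = A *m x t + b) ->
  forall v t, D t -> pd v xh t = A *m pd v x t.
Proof.
move=> Dop sx xhE v t Dt.
have dx : differentiable (on_plane x) (plane_pt t) by exact: (sx [::]).
have dA := is_derive_affine A b (diff_derivable (v := plane_pt v) dx).
rewrite /pd -[RHS](@derive_val _ _ _ _ _ _ _ dA).
apply: near_eq_derive.
by apply: filterS (near_plane (open_nbhs_nbhs (conj Dop Dt))) => p /xhE.
Qed.

(** The differential of xh - A x vanishes, since it vanishes on the two coordinate
directions. *)
Lemma affine_of_pd D xh x A : domain D -> smooth_on D xh -> smooth_on D x ->
  (forall t, D t -> pd 1 xh t = A *m pd 1 x t /\ pd 'i%C xh t = A *m pd 'i%C x t) ->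
  exists b, forall t, D t -> xh t = A *m x t + b.
Proof.
move=> Ddom sxh sx pdE.
have [[t0 Dt0]|D0] := pselect (exists t, D t); last first.
  by exists 0 => t Dt; exfalso; apply: D0; exists t.
exists (xh t0 - A *m x t0) => t Dt.
suff : forall s t, D s -> D t -> xh s - A *m x s = xh t - A *m x t.
  by move=> /(_ t t0 Dt Dt0) <-; rewrite addrCA subrr addr0.
apply: locally_constant => // {t Dt t0 Dt0} t Dt.
have nD := near_plane (open_nbhs_nbhs (conj Ddom.1 Dt)).
have xdiff y s (p : R * R) : smooth_on D y -> D s -> p = plane_pt s ->
    differentiable (on_plane y) p.
  by move=> sy Ds ->; exact: (sy [::]).
have dcoord n (f : R * R -> 'cV[R]_n) p i : differentiable f p ->
    differentiable (fun q => f q i 0) p.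
  move=> df; apply: (@differentiable_comp _ _ _ _ f (fun M => M i 0)) => //.
  exact: differentiable_coord.
suff : forall i, \forall s \near (t : R[i]^o),
    (xh s - A *m x s) i 0 = (xh t - A *m x t) i 0.
  move=> H; apply: filterS (filter_forall _ H) => s Hs.
  by apply/matrixP => i j; rewrite ord1.
move=> i.
pose f (p : R * R) := (on_plane xh p - A *m on_plane x p) i 0.
suff : \forall q \near plane_pt t, f q = f (plane_pt t).
  move/plane_near; apply: filterS => s; rewrite /f /on_plane /=.
  by case: s; case: t {Dt nD f} => a b a' b'.
have dA p v : derivable (on_plane x) p v ->
    is_derive p v (fun q => A *m on_plane x q) (A *m 'D_v (on_plane x) p).
  move=> H; have := is_derive_affine A 0 H.
  by under eq_fun do rewrite addr0.
have key : \forall q \near plane_pt t,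
    differentiable f q /\ ('D_(1, 0) f q = 0 /\ 'D_(0, 1) f q = 0).
  apply: filterS nD => p Dp.
  have pE : p = plane_pt (p.1 +i* p.2) by case: p {Dp}.
  have d1 : differentiable (on_plane xh) p by exact: (xdiff _ _ _ sxh Dp pE).
  have d2 : differentiable (on_plane x) p by exact: (xdiff _ _ _ sx Dp pE).
  have Dv v : 'D_v (on_plane xh) p = A *m 'D_v (on_plane x) p -> 'D_v f p = 0.
    move=> E.
    have H : is_derive p v (fun q => on_plane xh q - A *m on_plane x q)
        ('D_v (on_plane xh) p - A *m 'D_v (on_plane x) p).
      apply: is_deriveB; first exact/derivableP/diff_derivable.
      exact/dA/diff_derivable.
    have [H1 H2] := H.
    have := derive_mx H1; rewrite H2 E subrr => /matrixP/(_ i 0).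
    by rewrite !mxE.
  split.
    rewrite (_ : f = (fun q => on_plane xh q i 0) -
        \sum_k (A i k \*: (fun q => on_plane x q k 0))); last first.
      apply/funext => q; rewrite /f !mxE !fctE /=; congr (_ - _).
      by rewrite fct_sumE; apply: eq_bigr.
    apply: differentiableB; first exact: dcoord.
    by apply: differentiable_sum => k; apply: differentiableZ; exact: dcoord.
  have [E1 E2] := pdE _ Dp.
  by split; apply: Dv; rewrite pE.
by apply: const_of_zero_differential; apply: filterS key => q [].
Qed.

Local Notation toC := (map_mx (real_complex R)).

Lemma PhiE x t : Phi x t = toC (pd 1 x t) - 'i%C *: toC (pd 'i%C x t).
Proof. by apply/matrixP => i j; rewrite ord1 !mxE. Qed.

Lemma Phi_linear (A : 'M[R]_4) xh x t :
  Phi xh t = toC A *m Phi x t <->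
  pd 1 xh t = A *m pd 1 x t /\ pd 'i%C xh t = A *m pd 'i%C x t.
Proof.
rewrite !PhiE mulmxBr -scalemxAr -!map_mxM; split=> [/matrixP H|[-> ->]//].
split; apply/matrixP => i j; have := H i j; rewrite !mxE => /eqP;
  rewrite eq_complex /= => /andP[/eqP + /eqP +];
  rewrite !(mul0r, mul1r, mulr0, mulr1, subr0, sub0r, add0r, addr0, oppr0);
  by [move=> -> _|move=> _ /oppr_inj ->].
Qed.

End Affine.

(** * Moebius transformations of holomorphic functions *)

(** The derivative of a Moebius transform gh of g, in terms of the product rule
applied to gh (c g + d) = a g + b. *)
Lemma mobius_deriv_algebra (C : fieldType) (a b c d g dg gh dgh : C) :
  c * g + d != 0 -> gh * (c * g + d) = a * g + b ->
  dgh * (c * g + d) + gh * (c * dg) = a * dg ->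
  dgh * (c * g + d) ^+ 2 = (a * d - b * c) * dg.
Proof.
move=> n0 E1 E2.
have -> : dgh * (c * g + d) ^+ 2 =
  (dgh * (c * g + d) + gh * (c * dg)) * (c * g + d) - gh * (c * g + d) * (c * dg).
  by ring.
by rewrite E1 E2; ring.
Qed.

Lemma near_derive_mobius (K : numFieldType) (g gh : K^o -> K^o) (t a b c d : K) :
  derivable g t 1 -> derivable gh t 1 ->
  (\forall s \near (t : K^o), gh s * (c * g s + d) = a * g s + b) ->
  c * g t + d != 0 ->
  'D_1 gh t * (c * g t + d) ^+ 2 = (a * d - b * c) * 'D_1 g t.
Proof.
move=> dg dgh E n0.
have I0 k l : is_derive (t : K^o) (1 : K^o)
    (fun s => k * g s + l : K^o) (k * 'D_1 g t).
  have H : is_derive (t : K^o) (1 : K^o) ((k \*: g) + cst l) (k *: 'D_1 g t + 0).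
    apply: is_deriveD; apply: is_deriveZ; exact: derivableP.
  by rewrite addr0 in H.
have I1 : is_derive (t : K^o) (1 : K^o) (gh * (fun s => c * g s + d : K^o))
   (gh t *: (c * 'D_1 g t) + (c * g t + d) *: 'D_1 gh t).
  apply: is_deriveM; exact: derivableP.
have E2 := @near_eq_derive K K^o K^o _ _ t 1 E.
have E3 := @derive_val _ _ _ _ _ _ _ I1.
have E4 := @derive_val _ _ _ _ _ _ _ (I0 a b).
apply: (mobius_deriv_algebra n0 (nbhs_singleton E)).
rewrite -E4 -E2 -[RHS]/('D_1 (gh * (fun s => c * g s + d : K^o)) t) E3.
by rewrite addrC [in RHS]/GRing.scale /= [in X in _ = _ + X]mulrC.
Qed.

Section Limits.
Variables (K : numFieldType) (T : Type) (l : set_system T).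
Context {ll : Filter l}.
Implicit Types F G : T -> K.

Lemma cvg_quotient F G (a b : K) :
  F @ l --> a -> G @ l --> b -> b != 0 -> F s / G s @[s --> l] --> a / b.
Proof. by move=> cF cG n0; apply: cvgM => //; exact: (cvgV n0 cG). Qed.

Lemma cvg_affine_mul F G H (a b c k k' m m' : K) :
  F @ l --> a -> G @ l --> b -> H @ l --> c ->
  F s * (k * G s + k') * (m * H s + m') @[s --> l] -->
  a * (k * b + k') * (m * c + m').
Proof.
move=> cF cG cH; apply: cvgM; first apply: cvgM => //.
all: by apply: cvgD; [apply: cvgM => //; exact: cvg_cst|exact: cvg_cst].
Qed.

Lemma cvg_scale F (a k : K) : F @ l --> a -> k * F s @[s --> l] --> k * a.
Proof. by move=> cF; apply: cvgM => //; exact: cvg_cst. Qed.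

End Limits.

Section Hol.
Variable R : realType.
Implicit Types (D : set R[i]).

Lemma cderiv_mobius D (g gh : R[i] -> R[i]) a b c d :
  open (D : set R[i]^o) -> holomorphic_on D g -> holomorphic_on D gh ->
  (forall t, D t -> c * g t + d != 0 /\ gh t = (a * g t + b) / (c * g t + d)) ->
  forall t, D t ->
  cderiv gh t * (c * g t + d) ^+ 2 = (a * d - b * c) * cderiv g t.
Proof.
move=> Dop hg hgh E t Dt.
rewrite /cderiv !derive1E.
apply: near_derive_mobius; [exact: hg|exact: hgh| |by case: (E t Dt)].
apply: filterS (open_nbhs_nbhs (conj Dop Dt)) => s /E[n0 ->].
by rewrite divfK.
Qed.

Lemma holomorphic_continuous D (g : R[i] -> R[i]) t :
  holomorphic_on D g -> D t ->
  (g s : R[i]^o) @[s --> (t : R[i]^o)] --> (g t : R[i]^o).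
Proof.
move=> hg Dt; apply: differentiable_continuous; apply/derivable1_diffP.
exact: hg.
Qed.

(** The quotient F / G is continuous with values 1 and -1, hence locally
constant. *)
Lemma equal_squares_sign D (F G : R[i] -> R[i]) : domain D ->
  (forall t, D t -> (F s : R[i]^o) @[s --> (t : R[i]^o)] --> (F t : R[i]^o)) ->
  (forall t, D t -> (G s : R[i]^o) @[s --> (t : R[i]^o)] --> (G t : R[i]^o)) ->
  (forall t, D t -> G t != 0 /\ F t ^+ 2 = G t ^+ 2) ->
  exists e : R[i], (e = 1 \/ e = -1) /\ forall t, D t -> F t = e * G t.
Proof.
move=> Ddom cF cG FG.
have [[t0 Dt0]|D0] := pselect (exists t, D t); last first.
  by exists 1; split; [left|move=> t Dt; exfalso; apply: D0; exists t].
pose q s := F s / G s.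
have q1 t : D t -> q t = 1 \/ q t = -1.
  move=> /FG[n0 E]; have /eqP : q t ^+ 2 = 1.
    by rewrite /q expr_div_n E divff// expf_neq0.
  by rewrite sqrf_eq1 => /orP[] /eqP ->; [left|right].
exists (q t0); split; first exact: q1.
move=> t Dt; have [n0 _] := FG t Dt.
suff <- : q t = q t0 by rewrite /q divfK.
apply: (@locally_constant _ _ D) => // {t Dt n0 t0 Dt0} t Dt.
have [n0 _] := FG t Dt.
have cq : (q s : R[i]^o) @[s --> (t : R[i]^o)] --> (q t : R[i]^o).
  apply: (@cvg_quotient R[i] R[i]^o (nbhs (t : R[i]^o)) _ F G) => //.
  - exact: cF.
  - exact: cG.
have /cvgrPdist_lt/(_ 1 ltr01) := cq.
apply: filterS2 (open_nbhs_nbhs (conj Ddom.1 Dt)) => s Ds.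
have n2 : (`|1 + 1 : R[i]| < 1) = false.
  by rewrite (_ : 1 + 1 = 2%:R)// normr_nat (ltr_nat _ 2 1).
case: (q1 s Ds) (q1 t Dt) => -> [] ->//.
  by rewrite -opprD normrN n2.
by rewrite opprK n2.
Qed.

Lemma weierstrass_spinor D (x : R[i] -> 'cV[R]_4) (g1 g2 : R[i] -> R[i]) :
  canonical_weierstrass D x g1 g2 -> exists r : R[i] -> R[i],
   [/\ holomorphic_on D r,
       forall t, D t -> r t ^+ 2 = cderiv g1 t * cderiv g2 t,
       forall t, D t -> r t != 0 &
       forall t, D t -> spinor_coord R[i] *m Phi x t =
                        (r t)^-1 *: tensor (g1 t) 1 (g2 t) 1].
Proof.
case=> h1 h2 n0 _ [r [hr r2 E]]; exists r; split=> // t Dt.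
  by move: (n0 t Dt); rewrite -r2// expf_eq0.
have [E0 E1 E2 E3] := E t Dt.
apply: spinor_coord_weierstrass.
- rewrite -complexiE -E0; congr (Phi x t _ _); exact: val_inj.
- rewrite -E1; congr (Phi x t _ _); exact: val_inj.
- rewrite -E2; congr (Phi x t _ _); exact: val_inj.
- rewrite -E3; congr (Phi x t _ _); exact: val_inj.
Qed.

End Hol.

Lemma mobius_square (T : comNzRingType) (rh r n1 n2 dh1 dh2 d1 d2 D D' N : T) :
  rh ^+ 2 = dh1 * dh2 -> r ^+ 2 = d1 * d2 ->
  dh1 * n1 ^+ 2 = D * d1 -> dh2 * n2 ^+ 2 = D' * d2 -> N ^+ 2 = D * D' ->
  (rh * n1 * n2) ^+ 2 = (N * r) ^+ 2.
Proof.
move=> hrh hr h1 h2 hN.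
transitivity ((dh1 * n1 ^+ 2) * (dh2 * n2 ^+ 2)).
  by rewrite !exprMn hrh; ring.
by rewrite h1 h2 exprMn hr hN; ring.
Qed.

(** * Moebius equivalence and Lorentz congruence *)

Theorem theorem12p2 (R : realType) (D : set R[i])
    (xh x : R[i] -> 'cV[R]_4) (gh1 gh2 g1 g2 : R[i] -> R[i])
    (D_domain : domain D)
    (surf_xh : minimal_spacelike_general_type D xh)
    (surf_x : minimal_spacelike_general_type D x)
    (canon_xh : canonical_first_type_on D xh)
    (canon_x : canonical_first_type_on D x)
    (weier_xh : canonical_weierstrass D xh gh1 gh2)
    (weier_x : canonical_weierstrass D x g1 g2) :
  (exists (A : 'M[R]_4) (b : 'cV[R]_4),
     SO31 A /\ forall t, D t -> xh t = A *m x t + b)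
  <->
  (exists a b c d : R[i],
     a * d - b * c != 0 /\
     forall t, D t ->
       [/\ c * g1 t + d != 0,
           gh1 t = (a * g1 t + b) / (c * g1 t + d),
           - b^* * g2 t + a^* != 0 &
           gh2 t = (d^* * g2 t - c^*) / (- b^* * g2 t + a^*)]).
Proof.
have [[[sxh _] _ _ _] [[sx _] _ _ _]] := (surf_xh, surf_x).
have [rh [hrh rh2 rh0 WPhih]] := weierstrass_spinor weier_xh.
have [r [hr r2 r0 WPhi]] := weierstrass_spinor weier_x.
have [hgh1 hgh2 _ _ _] := weier_xh; have [hg1 hg2 _ _ _] := weier_x.
split.
- move=> [A [b0 [SA xhE]]].
  have [e [a [b [c [d [_ D0 WA]]]]]] := SO31_spin SA.
  exists a, b, c, d; split=> // t Dt.
  have PhiA : Phi xh t = map_mx (real_complex R) A *m Phi x t.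
    by apply/Phi_linear; split; apply: pd_affine D_domain.1 sx xhE _ _ Dt.
  have rhV0 : (rh t)^-1 != 0 by rewrite invr_eq0 rh0.
  have : (rh t)^-1 *: tensor (gh1 t) 1 (gh2 t) 1 = (e * (r t)^-1) *:
      tensor (a * g1 t + b) (c * g1 t + d)
             (d^* * g2 t - c^*) (- b^* * g2 t + a^*).
    rewrite -WPhih// PhiA mulmxA WA -scalemxAl -mulmxA WPhi// -scalemxAr.
    by rewrite spin_mx_tensor !mulr1 scalerA.
  by case/(tensor_ratio rhV0).
- move=> [a [b [c [d [D0 M]]]]].
  have cd1 := @cderiv_mobius R D g1 gh1 a b c d D_domain.1 hg1 hgh1
    (fun t Dt => let: And4 n1 E1 _ _ := M t Dt in conj n1 E1).
  have M2 t : D t -> - b^* * g2 t + a^* != 0 /\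
      gh2 t = (d^* * g2 t + - c^*) / (- b^* * g2 t + a^*).
    by case/M.
  have cd2 := cderiv_mobius D_domain.1 hg2 hgh2 M2.
  have n0 : `|a * d - b * c| != 0 by rewrite normr_eq0.
  have [|||e [e1 rhE]] := @equal_squares_sign R D
    (fun t => rh t * (c * g1 t + d) * (- b^* * g2 t + a^*))
    (fun t => `|a * d - b * c| * r t) D_domain.
  + move=> t Dt.
    apply: (@cvg_affine_mul R[i] R[i]^o (nbhs (t : R[i]^o)) _ rh g1 g2).
    * exact: holomorphic_continuous hrh Dt.
    * exact: holomorphic_continuous hg1 Dt.
    * exact: holomorphic_continuous hg2 Dt.
  + move=> t Dt.
    apply: (@cvg_scale R[i] R[i]^o (nbhs (t : R[i]^o)) _ r).
    exact: holomorphic_continuous hr Dt.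
  + move=> t Dt; rewrite mulf_neq0 ?r0//; split=> //.
    apply: (mobius_square (rh2 t Dt) (r2 t Dt) (cd1 t Dt) (cd2 t Dt)).
    rewrite normCK; congr (_ * _).
    by rewrite rmorphB !rmorphM /= mulrNN [d^* * _]mulrC [c^* * _]mulrC.
  (* The sign e relating the two branches rh and r has to be the sign of A. *)
  have [A [SA WA]] := spin_SO31 e1 D0.
  suff [b0 xhE] : exists b0, forall t, D t -> xh t = A *m x t + b0.
    by exists A, b0.
  apply: affine_of_pd => // t Dt; apply/Phi_linear.
  apply: (can_inj (mulKmx (spinor_coord_unit R[i]))).
  rewrite mulmxA WA -scalemxAl -mulmxA WPhih// WPhi// -scalemxAr spin_mx_tensor.
  have [n1 -> n2 ->] := M t Dt.
  by rewrite !mulr1; apply: tensor_mobius; rewrite ?r0//; exact: rhE.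
Qed.
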